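(* Let $p$ be a prime, $s\ge1$, $m\ge2$. If $n>2m$, every maximum clique of the Grassmann graph $G_{p^s}(n,m)$ is a star. If $n=2m$, every maximum clique of $G_{p^s}(n,m)$ is either a star or a top.
   Context: $R=\mathbb{Z}_{p^s}$; vectors are row vectors. A set $\{\alpha_1,\dots,\alpha_k\}\subseteq R^n$ is unimodular if the matrix with rows $\alpha_i$ has a right inverse over $R$. For a submodule $V\subseteq R^n$, $\dim(V)$ is the largest size of a unimodular subset of $V$. A $k$-subspace ($k\ge1$) of $R^n$ is a submodule with a unimodular basis of $k$ vectors; the $0$-subspace is $\{0\}$. For $1\le m<n$, $G_{p^s}(n,m)$ has vertex set the $m$-subspaces of $R^n$, with $A\sim B$ iff $A\cap B$ is a linear subset of dimension $m-1$. A star is the set of all $m$-subspaces containing a fixed $(m-1)$-subspace; a top is the set of all $m$-subspaces contained in a fixed $(m+1)$-subspace. *)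

(* Defs.v *)
From HB Require Import structures.
From mathcomp Require Import all_boot all_order all_algebra.

Set Implicit Arguments.
Unset Strict Implicit.
Unset Printing Implicit Defensive.

Import GRing.Theory.

Local Open Scope ring_scope.

Section Graph.
Variables (T : finType) (e : rel T).

Definition clique (C : {set T}) : Prop :=
  {in C &, forall x y, x != y -> e x y}.

Definition maximum_clique (C : {set T}) : Prop :=
  clique C /\ forall D : {set T}, clique D -> (#|D| <= #|C|)%N.

End Graph.

Section Linear.
Variables (R : finComNzRingType) (n : nat).
Implicit Types S V : {set 'rV[R]_n}.

(* The matrix whose rows are the vectors of S; the order, that of the          *)
(* enumeration of S, is irrelevant below.                                      *)
Definition rows_mx S : 'M[R]_(#|S|, n) := \matrix_(i < #|S|) enum_val i.

Definition unimodular S : bool :=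
  [exists N : 'M[R]_(n, #|S|), rows_mx S *m N == 1%:M].

Definition submodule V : bool :=
  (0 \in V) && [forall a : R, forall x in V, forall y in V, a *: x + y \in V].

Definition udim V : nat :=
  \max_(S : {set 'rV[R]_n} | (S \subset V) && unimodular S) #|S|.

Definition lin_indep S : bool :=
  injectiveb (fun u : 'rV[R]_#|S| => u *m rows_mx S).

Definition lin_span S : {set 'rV[R]_n} :=
  [set u *m rows_mx S | u : 'rV[R]_#|S|].

Definition basis S V : bool := lin_indep S && (V == lin_span S).

(* For k = 0 the empty set is the only candidate basis, and V is then {0}:     *)
(* see subspace0.                                                              *)
Definition subspace (k : nat) V : bool :=
  submodule V &&
  [exists S : {set 'rV[R]_n}, [&& #|S| == k, unimodular S & basis S V]].

Lemma subspace0 V : subspace 0 V = (V == [set 0]).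
Proof.
have span0 : lin_span set0 = [set 0].
  apply/setP=> x; rewrite inE; apply/imsetP/eqP=> [[u _ ->]|->].
    by apply/rowP=> j; rewrite !mxE big1 // => -[i lti]; exfalso; rewrite cards0 in lti.
  by exists 0; rewrite ?mul0mx.
apply/andP/eqP=> [[_ /existsP[S /and3P[/eqP S0 _ /andP[_ /eqP->]]]]|->].
  by rewrite (cards0_eq S0) span0.
split; first apply/andP; first split; first by rewrite inE.
  apply/forallP=> a; apply/forall_inP=> x /set1P->; apply/forall_inP=> y /set1P->.
  by rewrite scaler0 addr0 inE.
apply/existsP; exists set0; rewrite cards0 eqxx /=; apply/andP; split.
  apply/existsP; exists 0; apply/eqP/matrixP=> -[i lti] j; exfalso.
  by rewrite cards0 in lti.
rewrite /basis span0 eqxx andbT; apply/injectiveP=> u v _.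
by apply/rowP=> -[i lti]; exfalso; rewrite cards0 in lti.
Qed.

End Linear.

Section Grassmann.
Variables (R : finComNzRingType) (n m : nat).

Definition grassmann : finType :=
  {V : {set 'rV[R]_n} | subspace m V}.

(* A :&: B need not be a subspace, i.e. need not have a unimodular basis.      *)
Definition grassmann_adj : rel grassmann := fun A B =>
  submodule (val A :&: val B) && (udim (val A :&: val B) == m.-1).

Definition is_star (C : {set grassmann}) : Prop :=
  exists P : {set 'rV[R]_n},
    subspace m.-1 P /\ C = [set A : grassmann | P \subset val A].

Definition is_top (C : {set grassmann}) : Prop :=
  exists Q : {set 'rV[R]_n},
    subspace m.+1 Q /\ C = [set A : grassmann | val A \subset Q].

End Grassmann.

Arguments grassmann_adj {R n m} A B.

(* Main.v *)
(** Let R be a finite local chain ring with residue field F of order q, such as Z/p^s, and put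
    k = n - m.  Two members A, B of a clique C whose residues (images over F) differ meet in a
    subspace of dimension m - 1 and span one of dimension m + 1.  If some member has its residue
    outside that of A + B, then every member contains A :&: B and C lies in a star; dually, if
    the residue of some member does not contain that of A :&: B, then every member lies in A + B
    and C lies in a top.  Otherwise all residues lie in a pencil, or are equal, and there are
    fewer than q^2 of them.  The last case is excluded by counting: a maximum clique has at least
    as many members as a large star, namely |R|^k, whereas the members with a given residue are
    graphs of m x k matrices over the maximal ideal J differing pairwise by matrices of rank at
    most one.  Such matrices are separated by the syndrome, in J^k, of a rank-metric code built from
    multiplication in the field of order q^k, so there are at most |J|^k of them.  As |R| = q |J|,
    a maximum clique has at least q^k residues, while fewer than q^(m+1) occur in a top. *)

Require Import Defs.
From HB Require Import structures.
From mathcomp Require Import all_boot all_order all_algebra all_field.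
From mathcomp Require Import mxabelem.

Set Implicit Arguments.
Unset Strict Implicit.
Unset Printing Implicit Defensive.

Import GRing.Theory passmx.

Local Open Scope ring_scope.

Definition addset (V : finZmodType) (A B : {set V}) : {set V} := [set x + y | x in A, y in B].

Local Notation "A :+: B" := (addset A B) (at level 52, left associativity).

Lemma addsetP (V : finZmodType) (A B : {set V}) z :
  reflect (exists2 x, x \in A & exists2 y, y \in B & z = x + y) (z \in A :+: B).
Proof.
apply: (iffP imset2P) => [[x y Ax By ->]|[x Ax [y By ->]]]; last by exists x y.
by exists x => //; exists y.
Qed.

Lemma addsetC (V : finZmodType) (A B : {set V}) : A :+: B = B :+: A.
Proof.
by apply/setP=> z; apply/addsetP/addsetP=> -[x Ax [y By ->]];
  exists y => //; exists x; rewrite // addrC.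
Qed.

Section RowSpan.

Variable R : finComNzRingType.

Definition unimodular_mx (k n : nat) (M : 'M[R]_(k, n)) : bool :=
  [exists N : 'M[R]_(n, k), M *m N == 1%:M].

Definition row_span (k n : nat) (M : 'M[R]_(k, n)) : {set 'rV[R]_n} :=
  [set u *m M | u : 'rV[R]_k].

Lemma unimodular_mxP k n (M : 'M[R]_(k, n)) :
  reflect (exists N, M *m N = 1%:M) (unimodular_mx M).
Proof. exact: 'exists_eqP. Qed.

Lemma unimodular_mxMl k l n (U : 'M[R]_(k, l)) (M : 'M[R]_(l, n)) :
  unimodular_mx (U *m M) -> unimodular_mx U.
Proof.
by case/unimodular_mxP=> N; rewrite -mulmxA => UMN; apply/unimodular_mxP; exists (M *m N).
Qed.

Lemma unimodular_mxM k l n (U : 'M[R]_(k, l)) (M : 'M[R]_(l, n)) :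
  unimodular_mx U -> unimodular_mx M -> unimodular_mx (U *m M).
Proof.
case/unimodular_mxP=> N UN /unimodular_mxP[P MP]; apply/unimodular_mxP.
by exists (P *m N); rewrite mulmxA -(mulmxA U) MP mulmx1.
Qed.

Lemma row_spanP k n (M : 'M[R]_(k, n)) x :
  reflect (exists u, x = u *m M) (x \in row_span M).
Proof. by apply: (iffP imsetP) => [[u _ ->]|[u ->]]; exists u. Qed.

Lemma row_in_span k n (M : 'M[R]_(k, n)) i : row i M \in row_span M.
Proof. by apply/row_spanP; exists (delta_mx 0 i); rewrite rowE. Qed.

Lemma row_span_subP k l n (W : 'M[R]_(k, n)) (M : 'M[R]_(l, n)) :
  reflect (exists U, W = U *m M) (row_span W \subset row_span M).
Proof.
apply: (iffP subsetP) => [sub_WM|[U ->] x /row_spanP[u ->]]; last first.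
  by apply/row_spanP; exists (u *m U); rewrite mulmxA.
have /fin_all_exists[u uP] i : exists u, row i W = u *m M.
  exact/row_spanP/sub_WM/row_in_span.
by exists (\matrix_i u i); apply/row_matrixP=> i; rewrite row_mul rowK.
Qed.

Lemma submoduleP n (V : {set 'rV[R]_n}) :
  reflect (0 \in V /\ forall a, {in V &, forall x y, a *: x + y \in V}) (submodule V).
Proof.
apply: (iffP andP) => -[V0 VP]; split=> //.
  by move=> a x y Vx Vy; apply: (forall_inP (forall_inP (forallP VP a) x Vx)).
by apply/forallP=> a; apply/forall_inP=> x Vx; apply/forall_inP=> y; apply: VP.
Qed.

Lemma submodule_row_span k n (M : 'M[R]_(k, n)) : submodule (row_span M).
Proof.
apply/submoduleP; split; first by apply/row_spanP; exists 0; rewrite mul0mx.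
move=> a _ _ /row_spanP[u ->] /row_spanP[v ->]; apply/row_spanP.
by exists (a *: u + v); rewrite mulmxDl scalemxAl.
Qed.

Lemma submoduleI n (V W : {set 'rV[R]_n}) :
  submodule V -> submodule W -> submodule (V :&: W).
Proof.
move=> /submoduleP[V0 VP] /submoduleP[W0 WP]; apply/submoduleP.
split=> [|a x y]; first by rewrite inE V0.
by rewrite !inE => /andP[Vx Wx] /andP[Vy Wy]; rewrite VP // WP.
Qed.

Lemma row_span_sub_submodule k n (M : 'M[R]_(k, n)) (V : {set 'rV[R]_n}) :
  submodule V -> (forall i, row i M \in V) -> row_span M \subset V.
Proof.
case/submoduleP=> V0 VP VM; apply/subsetP=> _ /row_spanP[u ->].
rewrite mulmx_sum_row; elim/big_ind: _ => // [x y Vx Vy|i _].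
  by rewrite -[x]scale1r VP.
by rewrite -[_ *: _]addr0 VP.
Qed.

Lemma row_span_vector_sub n (y : 'rV[R]_n) (V : {set 'rV[R]_n}) :
  submodule V -> y \in V -> row_span y \subset V.
Proof. by move=> modV Vy; apply: row_span_sub_submodule => // i; rewrite ord1 row_id. Qed.

Lemma submodule_addset n (V W : {set 'rV[R]_n}) :
  submodule V -> submodule W -> submodule (V :+: W).
Proof.
move=> /submoduleP[V0 VP] /submoduleP[W0 WP]; apply/submoduleP; split.
  by apply/addsetP; exists 0 => //; exists 0; rewrite ?addr0.
move=> a _ _ /addsetP[x Vx [y Wy ->]] /addsetP[x' Vx' [y' Wy' ->]]; apply/addsetP.
exists (a *: x + x'); first exact: VP.
by exists (a *: y + y'); [apply: WP|rewrite scalerDr addrACA].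
Qed.

Lemma addset_subl n (A B : {set 'rV[R]_n}) : submodule B -> A \subset A :+: B.
Proof.
case/submoduleP=> B0 _; apply/subsetP=> x Ax; apply/addsetP.
by exists x => //; exists 0; rewrite ?addr0.
Qed.

Lemma addset_subr n (A B : {set 'rV[R]_n}) : submodule A -> B \subset A :+: B.
Proof. by rewrite addsetC; apply: addset_subl. Qed.

Lemma addset_sub_submodule n (A B V : {set 'rV[R]_n}) :
  submodule V -> A \subset V -> B \subset V -> A :+: B \subset V.
Proof.
case/submoduleP=> _ VP /subsetP AV /subsetP BV; apply/subsetP=> _ /addsetP[x Ax [y By ->]].
by rewrite -[x]scale1r; apply: VP; [apply: AV|apply: BV].
Qed.

Lemma row_span_col_mx k l n (A : 'M[R]_(k, n)) (B : 'M[R]_(l, n)) :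
  row_span (col_mx A B) = row_span A :+: row_span B.
Proof.
apply/setP=> z; apply/row_spanP/addsetP=> [[u ->]|[_ /row_spanP[v ->] [_ /row_spanP[w ->] ->]]].
  rewrite -[u]hsubmxK mul_row_col; exists (lsubmx u *m A); first by apply/row_spanP; eexists.
  by exists (rsubmx u *m B) => //; apply/row_spanP; eexists.
by exists (row_mx v w); rewrite mul_row_col.
Qed.

Lemma unimodular_rows k n (M : 'M[R]_(k, n)) : unimodular_mx M ->
  exists S : {set 'rV[R]_n}, [/\ #|S| = k, unimodular S & lin_span S = row_span M].
Proof.
case/unimodular_mxP=> N MN; pose S := [set row i M | i : 'I_k].
have row_inj : injective (fun i => row i M).
  move=> i j /(congr1 (mulmx^~ N)); rewrite /= -!row_mul MN => /rowP/(_ j).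
  by rewrite !mxE eqxx; case: eqP => // _ /eqP; rewrite eq_sym oner_eq0.
have /fin_all_exists[f fP] (i : 'I_#|S|) : exists j, enum_val i = row j M.
  by have /imsetP[j _ ->] := enum_valP i; exists j.
have f_inj : injective f by move=> i j fij; apply: enum_val_inj; rewrite !fP fij.
have rowsE : rows_mx S = rowsub f M.
  by apply/row_matrixP=> i; rewrite rowK fP row_rowsub.
exists S; split; first by rewrite card_imset // card_ord.
  apply/unimodular_mxP; exists (colsub f N).
  by rewrite rowsE -mxsub_mul MN; apply/matrixP=> i j; rewrite !mxE (inj_eq f_inj).
apply/eqP; rewrite eqEsubset; apply/andP; split.
  apply: row_span_sub_submodule (submodule_row_span M) _ => i.
  by rewrite rowsE row_rowsub row_in_span.
apply: row_span_sub_submodule (submodule_row_span (rows_mx S)) _ => i.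
have Si : row i M \in S by apply: imset_f.
by rewrite -(enum_rankK_in Si Si) -(rowK enum_val) row_in_span.
Qed.

Lemma subspaceP k n (V : {set 'rV[R]_n}) :
  reflect (exists2 M : 'M[R]_(k, n), unimodular_mx M & V = row_span M) (subspace k V).
Proof.
apply: (iffP andP) => [[_ /existsP[S /and3P[/eqP<- unimS /andP[_ /eqP VE]]]]|].
  by exists (rows_mx S).
case=> M unimM ->; split; first exact: submodule_row_span.
have [S [cardS unimS spanS]] := unimodular_rows unimM.
apply/existsP; exists S; rewrite cardS unimS /basis spanS !eqxx andbT /=.
have /unimodular_mxP[N SN] := unimS.
by apply/injectiveP=> u v /(congr1 (mulmx^~ N)); rewrite -!mulmxA SN !mulmx1.
Qed.

Lemma subspace_row_span k n (M : 'M[R]_(k, n)) :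
  unimodular_mx M -> subspace k (row_span M).
Proof. by move=> unimM; apply/subspaceP; exists M. Qed.

Lemma subspace_submodule k n (V : {set 'rV[R]_n}) : subspace k V -> submodule V.
Proof. by case/andP. Qed.

Lemma subspace_sub_eq k n (V W : {set 'rV[R]_n}) :
  subspace k V -> subspace k W -> V \subset W -> V = W.
Proof.
move=> /subspaceP[A unimA ->] /subspaceP[B _ ->] sub_AB.
apply/eqP; rewrite eqEsubset sub_AB; apply/row_span_subP.
have /row_span_subP[U AE] := sub_AB; move: unimA; rewrite AE.
case/unimodular_mxMl/unimodular_mxP=> N /mulmx1C NU.
by exists N; rewrite mulmxA NU mul1mx.
Qed.

Lemma leq_udimP k n (V : {set 'rV[R]_n}) : submodule V ->
  reflect (exists2 W, subspace k W & W \subset V) (k <= udim V)%N.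
Proof.
move=> modV; apply: (iffP idP) => [le_k|[_ /subspaceP[M unimM ->] sub_MV]].
  have [|S /andP[/subsetP SV /unimodular_mxP[N SN]] udimE] :=
    @eq_bigmax_cond _ [pred S : {set 'rV[R]_n} | (S \subset V) && unimodular S]
      (fun S => #|S|).
    apply/card_gt0P; exists set0; rewrite inE sub0set; apply/unimodular_mxP.
    by exists 0; apply/matrixP=> -[i lt_i0] j; exfalso; rewrite cards0 in lt_i0.
  rewrite /udim udimE in le_k; pose f := widen_ord le_k.
  have f_inj : injective f by move=> i j [/val_inj].
  exists (row_span (rowsub f (rows_mx S))).
    apply/subspace_row_span/unimodular_mxP; exists (colsub f N).
    by rewrite -mxsub_mul SN; apply/matrixP=> i j; rewrite !mxE (inj_eq f_inj).
  by apply: row_span_sub_submodule => // i; rewrite row_rowsub rowK SV ?enum_valP.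
have [S [cardS unimS spanS]] := unimodular_rows unimM; rewrite -cardS.
apply: (leq_bigmax_cond (F := fun S : {set 'rV[R]_n} => #|S|)); rewrite unimS andbT.
apply: subset_trans sub_MV; rewrite -spanS; apply/subsetP=> x Sx.
by rewrite -(enum_rankK_in Sx Sx) -(rowK enum_val) row_in_span.
Qed.

End RowSpan.

Section GrassmannAdjacency.

Variables (R : finComNzRingType) (r n : nat).
Implicit Types (A B : grassmann R n r.+1) (P Q : {set 'rV[R]_n}).

Definition star P := [set A : grassmann R n r.+1 | P \subset val A].

Definition top Q := [set A : grassmann R n r.+1 | val A \subset Q].

Lemma grassmann_adjP A B : A != B ->
  reflect (exists2 W, subspace r W & W \subset val A :&: val B) (grassmann_adj A B).
Proof.
move=> neq_AB.
have modAB : submodule (val A :&: val B).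
  by apply: submoduleI; apply: subspace_submodule (valP _).
have udim_le : (udim (val A :&: val B) <= r)%N.
  rewrite leqNgt; apply: contra neq_AB => /(leq_udimP _ modAB)[W subW].
  rewrite subsetI -val_eqE => /andP[WA WB].
  by rewrite -(subspace_sub_eq subW (valP A) WA) (subspace_sub_eq subW (valP B) WB).
rewrite /grassmann_adj modAB eqn_leq udim_le; exact: leq_udimP.
Qed.

Lemma star_clique P : subspace r P -> clique grassmann_adj (star P).
Proof.
move=> subP A B; rewrite !inE => PA PB neq_AB; apply/(grassmann_adjP neq_AB).
by exists P => //; rewrite subsetI PA.
Qed.

End GrassmannAdjacency.

Arguments star {R} r {n} P.
Arguments top {R} r {n} Q.

Lemma exists_large_star (R : finComNzRingType) (r k : nat) :
  exists2 P : {set 'rV[R]_(k + r.+1)}, subspace r P &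
    (#|R| ^ k <= #|star r P|)%N.
Proof.
have -> : (k + r.+1 = k + 1 + r)%N by rewrite -addnA.
pose M w : 'M[R]_(1 + r, k + 1 + r) := block_mx (row_mx w 1%:M) 0 0 1%:M.
have unimM w : unimodular_mx (M w).
  apply/unimodular_mxP; exists (block_mx (col_mx 0 1%:M) 0 0 1%:M).
  by rewrite mulmx_block mul_row_col !(mulmx0, mul0mx, mulmx1, add0r, addr0) -scalar_mx_block.
pose A w : grassmann R (k + 1 + r) (1 + r) :=
  exist (fun V => subspace (1 + r) V) _ (subspace_row_span (unimM w)).
have A_inj : injective A.
  move=> v w [/eqP]; rewrite eqEsubset => /andP[/row_span_subP[U]]; rewrite -[U]submxK.
  rewrite mulmx_block !(mulmx0, mulmx1, addr0) => /eq_block_mx[+ _ _ _] _.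
  rewrite mul_mx_row => /eq_row_mx[->]; rewrite mulmx1 => <-.
  by rewrite mul1mx.
exists (row_span (dsubmx (M 0))).
  apply/subspace_row_span/unimodular_mxP; exists (col_mx 0 1%:M).
  by rewrite col_mxKd mul_row_col mul0mx mulmx1 add0r.
rewrite -[k in (#|R| ^ k)%N]mul1n -card_mx -(card_imset _ A_inj); apply: subset_leq_card.
apply/subsetP=> _ /imsetP[w _ ->]; rewrite inE; apply/row_span_subP.
by exists (row_mx 0 1%:M); rewrite mul_row_col mul0mx mul1mx add0r !col_mxKd.
Qed.

Section RankTheory.

Variable F : fieldType.

Lemma submx_eqrank k l n (A : 'M[F]_(k, n)) (B : 'M[F]_(l, n)) :
  (A <= B)%MS -> (\rank B <= \rank A)%N -> (B <= A)%MS.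
Proof. by move=> sAB; rewrite -(geq_leqif (mxrank_leqif_sup sAB)). Qed.

Lemma eqmx_cap_corank1 k l r n (W : 'M[F]_(k, n)) (A : 'M[F]_(l, n)) (B : 'M[F]_(r, n)) :
  (W <= A)%MS -> (W <= B)%MS -> (\rank A <= (\rank W).+1)%N -> ~~ (A <= B)%MS ->
  (A :&: B :=: W)%MS.
Proof.
move=> WA WB rankA nAB.
have WAB : (W <= A :&: B)%MS by rewrite sub_capmx WA.
apply/eqmxP; rewrite WAB andbT; apply: submx_eqrank WAB _.
rewrite -ltnS; apply: leq_trans rankA; rewrite ltnNge; apply: contra nAB => le_rank.
exact: submx_trans (submx_eqrank (capmxSl A B) le_rank) (capmxSr A B).
Qed.

Lemma sub_kermx_tr k l n (A : 'M[F]_(k, n)) (B : 'M[F]_(l, n)) :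
  (A <= kermx B^T)%MS = (B <= kermx A^T)%MS.
Proof. by rewrite !sub_kermx -(inj_eq trmx_inj) trmx_mul trmxK trmx0. Qed.

Lemma hyperplane_functional k l r n (P : 'M[F]_(k, n)) (X : 'M[F]_(l, n)) (Q : 'M[F]_(r, n)) :
  (P <= X)%MS -> (X <= Q)%MS -> (\rank X).+1 = \rank Q ->
  exists v : 'rV[F]_n,
    [/\ v != 0, (v <= kermx (P + Q^C)%MS^T)%MS & (Q :&: kermx v^T :=: X)%MS].
Proof.
move=> PX XQ rankX.
have rank_lt : (\rank (X + Q^C)%MS < n)%N.
  apply: leq_ltn_trans (mxrank_adds_leqif X Q^C%MS).1 _; rewrite mxrank_compl.
  by rewrite -[X in (_ < X)%N](subnKC (rank_leq_col Q)) ltn_add2r -rankX.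
have /rowV0Pn[v] : kermx (X + Q^C)%MS^T != 0.
  by rewrite -mxrank_eq0 mxrank_ker mxrank_tr -lt0n subn_gt0.
rewrite sub_kermx_tr => XQCv v_neq0; exists v; split=> //.
  by rewrite sub_kermx_tr; apply: submx_trans XQCv; rewrite addsmxS.
move: XQCv; rewrite addsmx_sub => /andP[Xv QCv].
apply: eqmx_cap_corank1; rewrite ?rankX //; apply: contra v_neq0 => Qv.
have : (1%:M <= kermx v^T)%MS.
  by apply: (submx_trans (B := (Q + Q^C)%MS)); rewrite ?sub1mx ?addsmx_compl_full ?addsmx_sub ?Qv.
by rewrite sub_kermx mul1mx -(inj_eq trmx_inj) trmxK trmx0.
Qed.

End RankTheory.

Lemma card_hyperplanes_between (F : finFieldType) (k l n : nat)
    (P : 'M[F]_(k, n)) (Q : 'M[F]_(l, n)) (S : {set 'M[F]_n}) : (P <= Q)%MS ->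
  (forall X, X \in S ->
     [/\ <<X>>%MS = X, (P <= X)%MS, (X <= Q)%MS & (\rank X).+1 = \rank Q]) ->
  (#|S| < #|F| ^ (\rank Q - \rank P))%N.
Proof.
move=> PQ hyperS; set K := kermx (P + Q^C)%MS^T.
have rankK : \rank K = (\rank Q - \rank P)%N.
  have := mxrank_sum_cap P Q^C%MS.
  have /eqP-> : (P :&: Q^C)%MS == 0 by rewrite -submx0 -(capmx_compl Q) capmxS.
  rewrite mxrank0 addn0 mxrank_compl mxrank_ker mxrank_tr => ->.
  by rewrite addnC subnDA subKn ?rank_leq_col.
have sub_S : S \subset [set <<Q :&: kermx v^T>>%MS | v in rowg K :\ 0].
  apply/subsetP=> X /hyperS[XE PX XQ rankX].
  have [v [v_neq0 vK vE]] := hyperplane_functional PX XQ rankX.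
  apply/imsetP; exists v; first by rewrite !inE v_neq0.
  by rewrite (eq_genmx vE) XE.
apply: leq_ltn_trans (subset_leq_card sub_S) _.
apply: leq_ltn_trans (leq_imset_card _ _) _.
by rewrite -rankK -card_rowg [X in (_ < X)%N](cardsD1 0) inE sub0mx.
Qed.

Definition nonsingular_family (F : fieldType) (m k : nat) (T : 'I_m -> 'M[F]_k) : Prop :=
  forall u : 'cV[F]_m, u != 0 -> \sum_l u l 0 *: T l \in unitmx.

Lemma nonsingular_family_lshift (F : fieldType) (m l k : nat) (T : 'I_(m + l) -> 'M[F]_k) :
  nonsingular_family T -> nonsingular_family (fun i => T (lshift l i)).
Proof.
move=> nonsingT u u_neq0; have := nonsingT (col_mx u 0); rewrite big_split_ord /=.
under eq_bigr => i _ do rewrite col_mxEu.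
under [X in _ + X]eq_bigr => i _ do rewrite col_mxEd mxE scale0r.
by rewrite big1_eq addr0; apply; apply: contraNneq u_neq0 => /eqP; rewrite col_mx_eq0 => /andP[].
Qed.

(* The matrices of multiplication by the members of a basis of L: a nonzero combination is the
   multiplication by a nonzero element, hence invertible. *)
Lemma nonsingular_family_fieldExt (K : fieldType) (L : fieldExtType K) :
  exists T : 'I_(\dim {:L}) -> 'M[K]_(\dim {:L}), nonsingular_family T.
Proof.
pose e := vbasis {:L}; have e_basis : basis_of {:L} e := vbasisP _.
have e_free := basis_free e_basis.
exists (fun l => mxof e e (amulr e`_l)) => u u_neq0; pose y := \sum_l u l 0 *: e`_l.
have -> : \sum_l u l 0 *: mxof e e (amulr e`_l) = mxof e e (amulr y).
  by rewrite !linear_sum; apply: eq_bigr => l _; rewrite !linearZ.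
have y_neq0 : y != 0.
  apply: contraNneq u_neq0 => y0; apply/eqP/colP=> l; rewrite mxE.
  by move/freeP: e_free => /(_ (u^~ 0) y0 l).
have : mxof e e (amulr y) *m mxof e e (amulr y^-1) = 1%:M.
  rewrite -mxof_comp // -(mxof1 e_free); congr mxof.
  by apply/lfunP=> x; rewrite !lfunE /= !lfunE /= mulfK.
by case/mulmx1_unit.
Qed.

Lemma nonsingular_family_Fp (p m k : nat) : prime p -> (0 < k)%N -> (m <= k)%N ->
  exists T : 'I_m -> 'M['F_p]_k, nonsingular_family T.
Proof.
move=> p_pr k_gt0 le_mk; have [L charL cardL] := pPrimePowerField p_pr k_gt0.
have := nonsingular_family_fieldExt (pPrimeCharType charL : fieldExtType 'F_p).
rewrite pprimeChar_dimf cardL pfactorK // -(subnKC le_mk) => -[T nonsingT].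
by eexists; apply: nonsingular_family_lshift nonsingT.
Qed.

Definition chain_ring (R : nzRingType) : Prop :=
  forall x y : R, (exists c, y = c * x) \/ (exists c, x = c * y).

Lemma chain_ring_common_divisor (R : finNzRingType) (I : finType) (f : I -> R) :
  chain_ring R -> I -> exists i, forall j, exists c, f j = c * f i.
Proof.
move=> chainR i0; pose ideal x := [set c * x | c : R].
case: (@arg_maxnP I i0 predT (fun i => #|ideal (f i)|)) => // i _ ideal_max.
exists i => j; case: (chainR (f i) (f j)) => // -[c fiE].
have ideal_sub : ideal (f i) \subset ideal (f j).
  apply/subsetP=> _ /imsetP[d _ ->]; apply/imsetP; exists (d * c) => //.
  by rewrite -mulrA -fiE.
have ideal_eq : ideal (f i) = ideal (f j).
  by apply/eqP; rewrite eqEcard ideal_sub; apply: ideal_max.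
have : f j \in ideal (f j) by apply/imsetP; exists 1; rewrite ?mul1r.
by rewrite -ideal_eq => /imsetP[d _ fjE]; exists d.
Qed.

(* If f i divides every f j, the vectors e_j - (f j / f i) e_i with j != i kill f. *)
Lemma chain_ring_unimodular_annihilator (R : finComNzRingType) (k : nat) (f : 'cV[R]_k.+1) :
  chain_ring R -> exists2 V : 'M[R]_(k, k.+1), unimodular_mx V & V *m f = 0.
Proof.
move=> chainR.
have [i /fin_all_exists[c cP]] := chain_ring_common_divisor (f^~ 0) chainR ord0.
pose e : 'M[R]_k.+1 := 1%:M - \col_j c j *m delta_mx 0 i.
exists (rowsub (lift i) e).
  apply/unimodular_mxP; exists (colsub (lift i) 1%:M).
  rewrite mul_rowsub_mx mulmxBl mul1mx -mulmxA -rowE; apply/matrixP=> j l.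
  by rewrite !mxE big_ord1 !mxE (inj_eq lift_inj) (negbTE (neq_lift i l)) mulr0 subr0.
rewrite mul_rowsub_mx mulmxBl mul1mx -mulmxA -rowE; apply/matrixP=> j l.
by rewrite !mxE big_ord1 !mxE ord1 -cP subrr.
Qed.

Section LocalRing.

(* By unit_rho below, R is local and its maximal ideal is the kernel of rho. *)
Variables (R : finComUnitRingType) (F : finFieldType) (rho : {rmorphism R -> F}) (sec : F -> R).
Hypothesis secK : cancel sec rho.
Hypothesis unit_rho : forall x, rho x != 0 -> x \is a GRing.unit.

Local Notation red := (map_mx rho).

Lemma map_mx_secK k n (A : 'M[F]_(k, n)) : red (map_mx sec A) = A.
Proof. by apply/matrixP=> i j; rewrite !mxE secK. Qed.

Lemma unitmx_red n (M : 'M[R]_n) : red M \in unitmx -> M \in unitmx.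
Proof. by rewrite !unitmxE det_map_mx unitfE; apply: unit_rho. Qed.

Lemma row_free_red k n (M : 'M[R]_(k, n)) : row_free (red M) = unimodular_mx M.
Proof.
apply/row_freeP/unimodular_mxP=> [[N MN]|[N /(congr1 red)]]; last first.
  by rewrite map_mxM map_mx1 => MN; exists (red N).
have unitMN : M *m map_mx sec N \in unitmx.
  by apply: unitmx_red; rewrite map_mxM map_mx_secK MN unitmx1.
by exists (map_mx sec N *m invmx (M *m map_mx sec N)); rewrite mulmxA mulmxV.
Qed.

Lemma unimodular_mx_completion k q (M : 'M[R]_(k, q + k)) :
  unimodular_mx M -> exists K : 'M[R]_(q, q + k), col_mx K M \in unitmx.
Proof.
rewrite -row_free_red => freeM.
have [K KE] : exists K : 'M[F]_(q, q + k), (K :=: (red M)^C)%MS.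
  have rankC : \rank (red M)^C = q by rewrite mxrank_compl (eqP freeM) addnK.
  by move: (row_base _) (eq_row_base (red M)^C%MS); rewrite rankC => K; exists K.
exists (map_mx sec K); apply: unitmx_red; rewrite map_col_mx map_mx_secK.
rewrite -row_full_unit -sub1mx -addsmxE (adds_eqmx KE (eqmx_refl _)) addsmxC sub1mx.
exact: addsmx_compl_full.
Qed.

(* The image of V in F^n, as the canonical matrix of its row space (genmx_residue), so that
   residues can be compared with =. *)
Definition residue (n : nat) (V : {set 'rV[R]_n}) : 'M[F]_n :=
  (\sum_(v in V) <<red v>>)%MS.

Lemma genmx_residue n (V : {set 'rV[R]_n}) : <<residue V>>%MS = residue V.
Proof. by rewrite genmx_sums; apply: eq_bigr => v _; rewrite genmx_id. Qed.

Lemma residue_subP k n (V : {set 'rV[R]_n}) (A : 'M[F]_(k, n)) :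
  reflect {in V, forall v, (red v <= A)%MS} (residue V <= A)%MS.
Proof. by apply: (iffP sumsmx_subP) => VA v /VA; rewrite genmxE. Qed.

Lemma red_sub_residue n (V : {set 'rV[R]_n}) : {in V, forall v, (red v <= residue V)%MS}.
Proof. exact/residue_subP/submx_refl. Qed.

Lemma residue_subPn k n (V : {set 'rV[R]_n}) (A : 'M[F]_(k, n)) :
  reflect (exists2 v, v \in V & ~~ (red v <= A)%MS) (~~ (residue V <= A)%MS).
Proof.
apply: (iffP idP) => [nVA|[v Vv]]; last by apply: contra => /residue_subP->.
apply/exists_inP; apply: contraR nVA => /exists_inPn VA.
by apply/residue_subP=> v /VA/negbNE.
Qed.

Lemma residue_subset n (V W : {set 'rV[R]_n}) : V \subset W -> (residue V <= residue W)%MS.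
Proof. by move/subsetP=> VW; apply/residue_subP=> v /VW; apply: red_sub_residue. Qed.

Lemma residue_row_span k n (M : 'M[R]_(k, n)) : (residue (row_span M) :=: red M)%MS.
Proof.
apply/eqmxP/andP; split.
  by apply/residue_subP=> _ /row_spanP[u ->]; rewrite map_mxM submxMl.
by apply/row_subP=> i; rewrite -map_row; apply/red_sub_residue/row_in_span.
Qed.

Lemma rank_residue k n (V : {set 'rV[R]_n}) : subspace k V -> \rank (residue V) = k.
Proof.
by case/subspaceP=> M; rewrite -row_free_red => /eqP rankM ->; rewrite residue_row_span.
Qed.

Lemma residue_addset n (V W : {set 'rV[R]_n}) : submodule V -> submodule W ->
  (residue (V :+: W) :=: residue V + residue W)%MS.
Proof.
move=> modV modW; apply/eqmxP/andP; split.
  apply/residue_subP=> _ /addsetP[x Vx [y Wy ->]].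
  by rewrite map_mxD addmx_sub_adds // red_sub_residue.
by rewrite addsmx_sub !residue_subset ?addset_subl ?addset_subr.
Qed.

Lemma residue_subE k n (V W : {set 'rV[R]_n}) : subspace k V -> subspace k W ->
  (residue V <= residue W)%MS = (residue V == residue W).
Proof.
move=> subV subW; apply/idP/eqP=> [VW|->] //.
rewrite -genmx_residue -[RHS]genmx_residue; apply/genmxP.
by rewrite VW submx_eqrank // (rank_residue subV) (rank_residue subW).
Qed.

Section ExtensionByVector.

Variables (k n : nat) (Q : {set 'rV[R]_n}) (y : 'rV[R]_n).
Hypotheses (subQ : subspace k Q) (Q'y : ~~ (red y <= residue Q)%MS).

Lemma unimodular_col_mx (M : 'M[R]_(k, n)) :
  unimodular_mx M -> Q = row_span M -> unimodular_mx (col_mx y M).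
Proof.
rewrite -!row_free_red => /eqP rankM QE; move: Q'y; rewrite QE residue_row_span => M'y.
rewrite /row_free eqn_leq rank_leq_row map_col_mx -addsmxE /= add1n.
rewrite -[X in (X < _)%N]rankM (ltn_leqif (mxrank_leqif_sup (addsmxSr _ _))).
by rewrite addsmx_sub submx_refl andbT.
Qed.

Lemma subspace_addset_vector : subspace k.+1 (row_span y :+: Q).
Proof.
have /subspaceP[M unimM QE] := subQ; rewrite QE -row_span_col_mx.
exact/subspace_row_span/unimodular_col_mx.
Qed.

Lemma mul_vector_in_eq0 (a : 'rV[R]_1) : a *m y \in Q -> a = 0.
Proof.
have /subspaceP[M unimM QE] := subQ; rewrite QE => /row_spanP[u ayE].
have /unimodular_mxP[N MN] := unimodular_col_mx unimM QE.
have : row_mx a (- u) *m col_mx y M = 0 by rewrite mul_row_col mulNmx ayE subrr.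
by move/(congr1 (mulmx^~ N)); rewrite -mulmxA MN mulmx1 mul0mx -row_mx0 => /eq_row_mx[].
Qed.

Lemma addset_vector_eq (Y : {set 'rV[R]_n}) :
  subspace k.+1 Y -> Q \subset Y -> y \in Y -> row_span y :+: Q = Y.
Proof.
move=> subY QY Yy; have modY := subspace_submodule subY.
apply: subspace_sub_eq subspace_addset_vector subY _; apply: addset_sub_submodule => //.
exact: row_span_vector_sub.
Qed.

End ExtensionByVector.

Section Corank1.

Variables (r n : nat) (W Y : {set 'rV[R]_n}).
Hypotheses (subW : subspace r W) (subY : subspace r.+1 Y) (WY : W \subset Y).

Lemma cap_corank1 q (Q : {set 'rV[R]_n}) :
  subspace q Q -> W \subset Q -> ~~ (residue Y <= residue Q)%MS -> Y :&: Q = W.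
Proof.
move=> subQ WQ /residue_subPn[y Yy Q'y]; apply/eqP; rewrite eqEsubset subsetI WY WQ !andbT.
have W'y : ~~ (red y <= residue W)%MS.
  by apply: contra Q'y => /submx_trans; apply; apply: residue_subset.
apply/subsetP=> z; rewrite inE -(addset_vector_eq subW W'y subY WY Yy).
case/andP=> /addsetP[_ /row_spanP[a ->] [w Ww ->]] Qz.
suff -> : a = 0 by rewrite mul0mx add0r.
have /submoduleP[_ QP] := subspace_submodule subQ.
apply: (mul_vector_in_eq0 subQ Q'y); rewrite -[X in X \in Q](addrK w) addrC -scaleN1r.
by apply: QP; rewrite // (subsetP WQ).
Qed.

Lemma addset_corank1 (Z : {set 'rV[R]_n}) :
  submodule Z -> Z \subset Y -> ~~ (residue Z <= residue W)%MS -> W :+: Z = Y.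
Proof.
move=> modZ ZY /residue_subPn[y Zy W'y].
have [modW modY] := (subspace_submodule subW, subspace_submodule subY).
apply/eqP; rewrite eqEsubset addset_sub_submodule //=.
rewrite -(addset_vector_eq subW W'y subY WY (subsetP ZY y Zy)).
have modWZ := submodule_addset modW modZ.
apply: addset_sub_submodule (addset_subl _ modZ) => //.
by apply: row_span_vector_sub => //; apply: (subsetP (addset_subr _ modW)).
Qed.

Lemma subspace_addset_corank1 (Z : {set 'rV[R]_n}) :
  subspace r.+1 Z -> W \subset Z -> ~~ (residue Y <= residue Z)%MS -> subspace r.+2 (Y :+: Z).
Proof.
move=> subZ WZ /residue_subPn[y Yy Z'y].
have [modY modZ] := (subspace_submodule subY, subspace_submodule subZ).
have W'y : ~~ (red y <= residue W)%MS.
  by apply: contra Z'y => /submx_trans; apply; apply: residue_subset.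
suff -> : Y :+: Z = row_span y :+: Z by apply: subspace_addset_vector.
have mody := submodule_row_span y; have modyZ := submodule_addset mody modZ.
have ZyZ := addset_subr Z mody.
apply/eqP; rewrite eqEsubset; apply/andP; split.
  apply: (addset_sub_submodule _ _ ZyZ) => //; rewrite -(addset_vector_eq subW W'y subY WY Yy).
  exact: addset_sub_submodule (addset_subl _ modZ) (subset_trans WZ ZyZ).
apply: addset_sub_submodule (submodule_addset modY modZ) _ (addset_subr _ modY).
exact: subset_trans (row_span_vector_sub modY Yy) (addset_subl _ modZ).
Qed.

End Corank1.

Local Notation res A := (residue (val A)).

Section CliqueGeometry.

Variables (r n : nat) (C : {set grassmann R n r.+1}).
Hypothesis cliqueC : clique grassmann_adj C.

Section Pair.

Variables A B : grassmann R n r.+1.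
Hypotheses (CA : A \in C) (CB : B \in C) (neq_res : res A != res B).

Lemma clique_common_subspace : exists2 W, subspace r W & W \subset val A :&: val B.
Proof.
have neq_AB : A != B by apply: contraNneq neq_res => ->.
exact/(grassmann_adjP neq_AB)/cliqueC.
Qed.

Lemma residue_nsub : ~~ (res A <= res B)%MS.
Proof. by rewrite (residue_subE (valP A) (valP B)). Qed.

Lemma subspace_clique_cap : subspace r (val A :&: val B).
Proof.
have [W subW] := clique_common_subspace; rewrite subsetI => /andP[WA WB].
by rewrite (cap_corank1 subW (valP A) WA (valP B) WB residue_nsub).
Qed.

Lemma subspace_clique_addset : subspace r.+2 (val A :+: val B).
Proof.
have [W subW] := clique_common_subspace; rewrite subsetI => /andP[WA WB].
exact: subspace_addset_corank1 subW (valP A) WA _ (valP B) WB residue_nsub.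
Qed.

Lemma residue_clique_cap :
  (res A :&: res B :=: residue (val A :&: val B))%MS.
Proof.
apply: eqmx_cap_corank1 residue_nsub; rewrite ?residue_subset ?subsetIl ?subsetIr //.
by rewrite (rank_residue (valP A)) (rank_residue subspace_clique_cap).
Qed.

End Pair.

Let modG (A : grassmann R n r.+1) := subspace_submodule (valP A).

(* As X leaves A + B modulo the maximal ideal, X meets A, B and A + B in the same module. *)
Lemma clique_cap_sub A B X : A \in C -> B \in C -> X \in C ->
  res A != res B -> ~~ (res X <= residue (val A :+: val B))%MS ->
  val A :&: val B \subset val X.
Proof.
move=> CA CB CX neqAB nXAB; have subAB := subspace_clique_addset CA CB neqAB.
have cap_X Y : Y \in C -> val Y \subset val A :+: val B ->
    subspace r (val X :&: val Y) /\ val X :&: (val A :+: val B) = val X :&: val Y.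
  move=> CY sub_Y.
  have neqXY : res X != res Y.
    by apply: contraNneq nXAB => ->; apply: residue_subset.
  have subXY := subspace_clique_cap CX CY neqXY; split=> //.
  apply: (cap_corank1 subXY (valP X) _ subAB) => //; first exact: subsetIl.
  by apply: subset_trans sub_Y; apply: subsetIr.
have [subXA XA] := cap_X A CA (addset_subl _ (modG B)).
have [_ XB] := cap_X B CB (addset_subr _ (modG A)).
suff <- : val X :&: val A = val A :&: val B by apply: subsetIl.
apply: subspace_sub_eq subXA (subspace_clique_cap CA CB neqAB) _.
by rewrite subsetI subsetIr -XA XB subsetIr.
Qed.

(* As X misses part of A :&: B modulo the maximal ideal, X :&: A and X :&: B are distinct there
   and generate X. *)
Lemma clique_sub_addset A B X : A \in C -> B \in C -> X \in C ->
  res A != res B -> ~~ (residue (val A :&: val B) <= res X)%MS ->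
  val X \subset val A :+: val B.
Proof.
move=> CA CB CX neqAB nABX; have subAB := subspace_clique_cap CA CB neqAB.
have cap_X Y : Y \in C -> val A :&: val B \subset val Y -> subspace r (val X :&: val Y).
  move=> CY sub_Y; apply: subspace_clique_cap => //.
  by apply: contraNneq nABX => ->; apply: residue_subset.
have subXA := cap_X A CA (subsetIl _ _); have subXB := cap_X B CB (subsetIr _ _).
have nXBXA : ~~ (residue (val X :&: val B) <= residue (val X :&: val A))%MS.
  apply: contra nABX => XBXA; apply: submx_trans (residue_subset (subsetIl _ (val B))).
  have : (residue (val X :&: val B) <= residue (val A :&: val B))%MS.
    rewrite -(residue_clique_cap CA CB neqAB) sub_capmx.
    apply/andP; split; last by apply/residue_subset/subsetIr.
    exact: submx_trans XBXA (residue_subset (subsetIr _ _)).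
  by rewrite (residue_subE subXB subAB) => /eqP->.
have modXB := subspace_submodule subXB.
rewrite -(addset_corank1 subXA (valP X) (subsetIl _ _) modXB (subsetIl _ _) nXBXA).
apply: addset_sub_submodule; first exact: submodule_addset.
  exact: subset_trans (subsetIr _ _) (addset_subl _ _).
exact: subset_trans (subsetIr _ _) (addset_subr _ _).
Qed.

Lemma clique_sub_star A B X : A \in C -> B \in C -> X \in C ->
  res A != res B -> ~~ (res X <= residue (val A :+: val B))%MS ->
  C \subset star r (val A :&: val B).
Proof.
move=> CA CB CX neqAB nXAB; apply/subsetP=> Y CY; rewrite inE.
have [YAB|] := boolP (res Y <= residue (val A :+: val B))%MS;
  last exact: clique_cap_sub.
wlog neqAY : A B CA CB neqAB nXAB YAB / res A != res Y.
  move=> IH; have [resAY|] := eqVneq (res A) (res Y); last exact: IH.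
  by rewrite setIC; apply: IH; rewrite // 1?addsetC // -?resAY // eq_sym.
have AAB := addset_subl (val A) (modG B).
have nXAY : ~~ (res X <= residue (val A :+: val Y))%MS.
  apply: contra nXAB => /submx_trans; apply.
  by rewrite (residue_addset (modG A) (modG Y)) addsmx_sub YAB residue_subset.
have neqAX : res A != res X.
  by apply: contraNneq nXAB => <-; apply: residue_subset.
have cap_AX Z : Z \in C -> res A != res Z ->
    ~~ (res X <= residue (val A :+: val Z))%MS -> val A :&: val Z = val A :&: val X.
  move=> CZ neqAZ nXAZ.
  have subAZ := subspace_clique_cap CA CZ neqAZ.
  apply: subspace_sub_eq subAZ (subspace_clique_cap CA CX neqAX) _.
  by rewrite subsetI subsetIl clique_cap_sub.
by rewrite (cap_AX B) // -(cap_AX Y) // subsetIr.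
Qed.

Lemma clique_sub_top A B X : A \in C -> B \in C -> X \in C ->
  res A != res B -> ~~ (residue (val A :&: val B) <= res X)%MS ->
  C \subset top r (val A :+: val B).
Proof.
move=> CA CB CX neqAB nABX; apply/subsetP=> Y CY; rewrite inE.
have [ABY|] := boolP (residue (val A :&: val B) <= res Y)%MS;
  last exact: clique_sub_addset.
wlog neqAY : A B CA CB neqAB nABX ABY / res A != res Y.
  move=> IH; have [resAY|] := eqVneq (res A) (res Y); last exact: IH.
  by rewrite addsetC; apply: IH; rewrite // 1?setIC // -?resAY // eq_sym.
have nAYX : ~~ (residue (val A :&: val Y) <= res X)%MS.
  apply: contra nABX; apply: submx_trans.
  by rewrite -(residue_clique_cap CA CY neqAY) sub_capmx ABY residue_subset ?subsetIl.
have neqAX : res A != res X.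
  by apply: contraNneq nABX => <-; rewrite residue_subset ?subsetIl.
have add_AX Z : Z \in C -> res A != res Z ->
    ~~ (residue (val A :&: val Z) <= res X)%MS -> val A :+: val X = val A :+: val Z.
  move=> CZ neqAZ nAZX.
  have subAX := subspace_clique_addset CA CX neqAX.
  apply: subspace_sub_eq subAX (subspace_clique_addset CA CZ neqAZ) _.
  by apply: addset_sub_submodule; rewrite ?submodule_addset ?addset_subl // clique_sub_addset.
by rewrite -(add_AX B) // (add_AX Y) // addset_subr.
Qed.

Lemma clique_trichotomy :
  [\/ exists2 P, subspace r P & C \subset star r P,
      exists2 Q, subspace r.+2 Q & C \subset top r Q |
      (#|[set res A | A in C]| < #|F| ^ 2)%N].
Proof.
have F_gt1 := finNzRing_gt1 F.
have [/exists_inP[A CA /exists_inP[B CB neqAB]]|/exists_inPn eq_res] :=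
  boolP [exists A in C, exists B in C, res A != res B]; last first.
  constructor 3; apply: (@leq_ltn_trans 1); last by rewrite -(expn0 #|F|) ltn_exp2l.
  apply/card_le1_eqP=> _ _ /imsetP[A CA ->] /imsetP[B CB ->].
  by have /exists_inPn/(_ B CB)/negPn/eqP := eq_res A CA.
have [/exists_inP[X CX nXAB]|/exists_inPn leAB] :=
  boolP [exists X in C, ~~ (res X <= residue (val A :+: val B))%MS].
  by constructor 1; exists (val A :&: val B);
    [apply: subspace_clique_cap|apply: clique_sub_star nXAB].
have [/exists_inP[X CX nABX]|/exists_inPn geAB] :=
  boolP [exists X in C, ~~ (residue (val A :&: val B) <= res X)%MS].
  by constructor 2; exists (val A :+: val B);
    [apply: subspace_clique_addset|apply: clique_sub_top nABX].
constructor 3; have rankI := rank_residue (subspace_clique_cap CA CB neqAB).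
have rankD := rank_residue (subspace_clique_addset CA CB neqAB).
have <- : (\rank (residue (val A :+: val B)) - \rank (residue (val A :&: val B)) = 2)%N.
  by rewrite rankI rankD -addn2 addKn.
apply: card_hyperplanes_between => [|_ /imsetP[X CX ->]].
  by apply: submx_trans (negPn (geAB A CA)) (negPn (leAB A CA)).
rewrite genmx_residue (rank_residue (valP X)) rankD.
by split=> //; apply/negPn; [apply: geAB|apply: leAB].
Qed.

End CliqueGeometry.

Lemma top_clique r n (Q : {set 'rV[R]_n}) : chain_ring R -> subspace r.+2 Q ->
  clique grassmann_adj (top r Q).
Proof.
move=> chainR /subspaceP[MQ unimQ ->] A B; rewrite !inE => AQ BQ neq_AB.
apply/(grassmann_adjP neq_AB); move: AQ BQ.
have /subspaceP[MA unimA ->] := valP A; have /subspaceP[MB unimB ->] := valP B.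
move=> /row_span_subP[U MAE] /row_span_subP[V MBE].
have [K unitKU] : exists K : 'M[R]_(1, 1 + r.+1), col_mx K U \in unitmx.
  by apply: unimodular_mx_completion; apply: (@unimodular_mxMl _ _ _ _ _ MQ); rewrite -MAE.
(* K *m MQ spans a complement of A in Q, and f lists the coordinates of MB along it. *)
pose f := V *m lsubmx (invmx (col_mx K U)); pose D := V *m rsubmx (invmx (col_mx K U)).
have MBE' : MB = f *m (K *m MQ) + D *m MA.
  rewrite MAE !mulmxA -mulmxDl MBE -!mulmxA -mulmxDr -mul_row_col hsubmxK.
  by rewrite mulVmx // mulmx1.
have [N unimN Nf] := chain_ring_unimodular_annihilator f chainR.
exists (row_span (N *m MB)); first exact/subspace_row_span/unimodular_mxM.
rewrite subsetI; apply/andP; split; apply/row_span_subP; last by exists N.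
by exists (N *m D); rewrite MBE' mulmxDr mulmxA Nf mul0mx add0r mulmxA.
Qed.

Definition maximal_ideal_vectors (k : nat) : {set 'rV[R]_k} := [set v | red v == 0].

Lemma card_maximal_ideal_vectors k :
  (#|maximal_ideal_vectors k| * #|F| ^ k = #|R| ^ k)%N.
Proof.
rewrite -[X in (#|F| ^ X)%N]mul1n -[X in (#|R| ^ X)%N]mul1n -!card_mx.
rewrite -[#|{: 'rV[F]_k}|]cardsT -cardsX -[RHS]cardsT.
pose f (x : 'rV[R]_k * 'rV[F]_k) := x.1 + map_mx sec x.2.
have red_f v w : red v = 0 -> red (f (v, w)) = w.
  by move=> v0; rewrite map_mxD map_mx_secK v0 add0r.
rewrite -(card_in_imset (f := f)); last first.
  move=> [v w] [v' w']; rewrite !inE /= !andbT => /eqP v0 /eqP v0' fE.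
  have ww' : w = w' by rewrite -(red_f v w v0) fE red_f.
  by move: fE; rewrite /f ww' => /addIr /= ->.
congr #|pred_of_set _|; apply/setP=> v; rewrite [RHS]inE; apply/imsetP.
exists (v - map_mx sec (red v), red v); last by rewrite /f subrK.
by rewrite !inE andbT map_mxB map_mx_secK subrr.
Qed.

Lemma annihilated_rank1 r k (U : 'M[R]_(r, r.+1)) (D : 'M[R]_(r.+1, k)) :
  unimodular_mx U -> U *m D = 0 ->
  exists c : 'cV[R]_r.+1, exists2 x : 'rV[R]_k, red c != 0 & D = c *m x.
Proof.
move=> unimU UD; have [K unitG] := unimodular_mx_completion (q := 1) unimU.
set G := col_mx K U in unitG; pose c := lsubmx (invmx G); exists c, (K *m D); last first.
  rewrite -[D in LHS](mulKmx unitG) -[invmx G]hsubmxK mul_col_mx UD mul_row_col mulmx0 addr0.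
  by rewrite mulmxA.
have Kc : K *m c = 1%:M.
  have := mulmxV unitG; rewrite -[invmx G]hsubmxK mul_col_row scalar_mx_block.
  by case/eq_block_mx.
apply/eqP=> red_c; have := congr1 red Kc.
by rewrite map_mxM red_c mulmx0 map_mx1 => /eqP; rewrite eq_sym oner_eq0.
Qed.

Section Graphs.

Variables (m k : nat) (K : 'M[R]_(k, k + m)) (M : 'M[R]_(m, k + m)).
Hypothesis unitKM : col_mx K M \in unitmx.

Definition graph_span (X : 'M[R]_(m, k)) : {set 'rV[R]_(k + m)} :=
  row_span (row_mx X 1%:M *m col_mx K M).

Lemma subspace_graph_span (V : {set 'rV[R]_(k + m)}) :
  subspace m V -> (residue V <= residue (row_span M))%MS ->
  exists2 X, red X = 0 & V = graph_span X.
Proof.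
case/subspaceP=> N unimN ->; rewrite !residue_row_span => /submxP[D redN].
pose G := col_mx K M; pose P := N *m invmx G.
have redP : red P = row_mx 0 D.
  have MG : M *m invmx G = row_mx 0 1%:M.
    by rewrite -[M in LHS](col_mxKd K) mul_dsub_mx mulmxV // scalar_mx_block col_mxKd.
  by rewrite map_mxM redN -mulmxA -map_mxM MG map_row_mx map_mx0 map_mx1 mul_mx_row mulmx0 mulmx1.
have [redY redU] : red (lsubmx P) = 0 /\ red (rsubmx P) = D.
  by rewrite map_lsubmx map_rsubmx redP row_mxKl row_mxKr.
have unitU : rsubmx P \in unitmx.
  apply: unitmx_red; rewrite redU -row_free_unit /row_free -(rank_row_0mx k) -redP.
  rewrite -/(row_free _) row_free_red; apply: (@unimodular_mxMl _ _ _ _ _ G).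
  by rewrite mulmxKV.
exists (invmx (rsubmx P) *m lsubmx P); first by rewrite map_mxM redY mulmx0.
have graphE : row_mx (invmx (rsubmx P) *m lsubmx P) 1%:M *m G = invmx (rsubmx P) *m N.
  by rewrite -(mulVmx unitU) -mul_mx_row hsubmxK -mulmxA mulmxKV.
rewrite /graph_span graphE; apply/eqP; rewrite eqEsubset; apply/andP.
split; apply/row_span_subP; last by eexists.
by exists (rsubmx P); rewrite mulKVmx.
Qed.

End Graphs.

Lemma graph_span_common_corank1 r k (K : 'M[R]_(k, k + r.+1)) (M : 'M[R]_(r.+1, k + r.+1)) X Y W :
  col_mx K M \in unitmx -> subspace r W -> W \subset graph_span K M X :&: graph_span K M Y ->
  exists c : 'cV[R]_r.+1, exists2 x : 'rV[R]_k, red c != 0 & X - Y = c *m x.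
Proof.
move=> unitKM /subspaceP[N unimN ->]; rewrite subsetI => /andP[/row_span_subP[U NE]].
case/row_span_subP=> V; rewrite NE !mulmxA => /(can_inj (mulmxK unitKM)).
rewrite !mul_mx_row !mulmx1 => /eq_row_mx[UX UV]; rewrite -UV in UX.
apply: (annihilated_rank1 (U := U)); last by rewrite mulmxBr UX subrr.
by apply: (unimodular_mxMl (M := row_mx X 1%:M *m col_mx K M)); rewrite -NE.
Qed.

Section Syndrome.

Variables (m k : nat) (T : 'I_m -> 'M[F]_k).
Hypothesis nonsingT : nonsingular_family T.

Definition syndrome (X : 'M[R]_(m, k)) : 'rV[R]_k := \sum_l row l X *m map_mx sec (T l).

Lemma syndromeB X Y : syndrome (X - Y) = syndrome X - syndrome Y.
Proof. by rewrite -sumrB; apply: eq_bigr => l _; rewrite linearB mulmxBl. Qed.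

Lemma red_syndrome X : red X = 0 -> red (syndrome X) = 0.
Proof.
move=> redX; rewrite raddf_sum big1 //= => l _.
by rewrite map_mxM map_row redX row0 mul0mx.
Qed.

Lemma syndrome_rank1_eq0 (c : 'cV[R]_m) (x : 'rV[R]_k) :
  red c != 0 -> syndrome (c *m x) = 0 -> c *m x = 0.
Proof.
move=> c_neq0; set G := \sum_l c l 0 *: map_mx sec (T l).
have -> : syndrome (c *m x) = x *m G.
  rewrite mulmx_sumr; apply: eq_bigr => l _.
  by rewrite row_mul [row l c]mx11_scalar mul_scalar_mx mxE -scalemxAl -scalemxAr.
have unitG : G \in unitmx.
  apply: unitmx_red; rewrite raddf_sum /=; have := nonsingT c_neq0; congr (_ \in unitmx).
  by apply: eq_bigr => l _; rewrite map_mxZ map_mx_secK mxE.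
by move/(congr1 (mulmx^~ (invmx G))); rewrite mulmxK // mul0mx => ->; rewrite mulmx0.
Qed.

End Syndrome.

Section CliqueSize.

Variables (r k : nat) (T : 'I_r.+1 -> 'M[F]_k) (C : {set grassmann R (k + r.+1) r.+1}).
Hypotheses (nonsingT : nonsingular_family T) (cliqueC : clique grassmann_adj C).

Lemma card_clique_fibre (A0 : grassmann R (k + r.+1) r.+1) :
  (#|[set A in C | res A == res A0]| <= #|maximal_ideal_vectors k|)%N.
Proof.
set fibre := [set A in C | _].
have /subspaceP[M unimM A0E] := valP A0.
have [K unitKM] := unimodular_mx_completion unimM.
have /fin_all_exists[X XP] (A : grassmann R (k + r.+1) r.+1) :
    exists X, A \in fibre -> red X = 0 /\ val A = graph_span K M X.
  have [|_] := boolP (A \in fibre); last by exists 0.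
  rewrite inE => /andP[_ /eqP resA].
  have [|X redX AE] := subspace_graph_span unitKM (valP A); first by rewrite resA A0E.
  by exists X.
have syndrome_inj : {in fibre &, injective (fun A => syndrome T (X A))}.
  move=> A B fibA fibB syndromeE; have [[_ AE] [_ BE]] := (XP A fibA, XP B fibB).
  have [//|neq_AB] := eqVneq A B.
  have [W subW] : exists2 W, subspace r W & W \subset val A :&: val B.
    move: fibA fibB; rewrite !inE => /andP[CA _] /andP[CB _].
    exact/(grassmann_adjP neq_AB)/cliqueC.
  rewrite AE BE => /(graph_span_common_corank1 unitKM subW)[c [x red_c XB]].
  have : syndrome T (X A - X B) = 0 by rewrite syndromeB syndromeE subrr.
  rewrite XB => /(syndrome_rank1_eq0 nonsingT red_c); rewrite -XB => /subr0_eq XAB.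
  by apply: val_inj; rewrite AE BE XAB.
rewrite -(card_in_imset syndrome_inj); apply: subset_leq_card.
apply/subsetP=> _ /imsetP[A fibA ->]; rewrite inE; apply/eqP/red_syndrome.
by have [] := XP A fibA.
Qed.

Lemma card_clique_le :
  (#|C| <= #|[set res A | A in C]| * #|maximal_ideal_vectors k|)%N.
Proof.
rewrite -sum1_card (partition_big_imset (fun A => res A)) -sum_nat_const.
apply: leq_sum => _ /imsetP[A0 _ ->]; rewrite sum1_card.
by apply: leq_trans (card_clique_fibre A0); rewrite cardsE.
Qed.

End CliqueSize.

Lemma card_residues_maximum_clique r k (T : 'I_r.+1 -> 'M[F]_k)
    (C : {set grassmann R (k + r.+1) r.+1}) :
  nonsingular_family T -> maximum_clique grassmann_adj C ->
  (#|F| ^ k <= #|[set res A | A in C]|)%N.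
Proof.
move=> nonsingT [cliqueC maxC].
have [P subP large_P] := exists_large_star R r k.
have := leq_trans (leq_trans large_P (maxC _ (star_clique subP))) (card_clique_le nonsingT cliqueC).
rewrite -card_maximal_ideal_vectors mulnC leq_pmul2r //.
by apply/card_gt0P; exists 0; rewrite inE map_mx0.
Qed.

Lemma card_residues_top r n (Q : {set 'rV[R]_n}) (C : {set grassmann R n r.+1}) :
  subspace r.+2 Q -> C \subset top r Q ->
  (#|[set res A | A in C]| < #|F| ^ r.+2)%N.
Proof.
move=> subQ /subsetP CQ.
have <- : (\rank (residue Q) - \rank (0%R : 'M[F]_n) = r.+2)%N.
  by rewrite mxrank0 subn0 (rank_residue subQ).
apply: card_hyperplanes_between => [|_ /imsetP[A CA ->]]; first exact: sub0mx.
rewrite genmx_residue sub0mx (rank_residue (valP A)) (rank_residue subQ).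
by split=> //; apply: residue_subset; have := CQ A CA; rewrite inE.
Qed.

Lemma maximum_clique_star_or_top r k (T : 'I_r.+1 -> 'M[F]_k)
    (C : {set grassmann R (k + r.+1) r.+1}) :
  chain_ring R -> nonsingular_family T -> (1 < k)%N -> maximum_clique grassmann_adj C ->
  is_star C \/ (is_top C /\ (k <= r.+1)%N).
Proof.
move=> chainR nonsingT k_gt1 maxC; have [cliqueC C_max] := maxC.
have many_res := card_residues_maximum_clique nonsingT maxC.
have F_gt1 := finNzRing_gt1 F.
have C_eq D : clique grassmann_adj D -> C \subset D -> C = D.
  by move=> cliqueD CD; apply/eqP; rewrite eqEcard CD C_max.
case: (clique_trichotomy cliqueC) => [[P subP CP]|[Q subQ CQ]|few_res].
- by left; exists P; split=> //; apply: C_eq CP; apply: star_clique.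
- right; split; first by exists Q; split=> //; apply: C_eq CQ; apply: top_clique.
  by have := leq_ltn_trans many_res (card_residues_top subQ CQ); rewrite ltn_exp2l.
- by have := leq_ltn_trans many_res few_res; rewrite ltn_exp2l // ltnNge k_gt1.
Qed.

End LocalRing.

Lemma Zp_dvd_of_gcd q (x y : 'Z_q) :
  (1 < q)%N -> (gcdn q x %| gcdn q y)%N -> exists c, y = c * x.
Proof.
move=> q_gt1 dvd_xy; have /dvdnP[d yE] := dvdn_trans dvd_xy (dvdn_gcdr _ _).
have [a _ /dvdnP[b bezout]] := Bezoutl x (ltnW q_gt1).
have /eqP : (gcdn q x)%:R + a%:R * x = 0.
  by rewrite -{2}[x]natr_Zp -natrM -natrD bezout natrM pchar_Zp ?mulr0.
rewrite addr_eq0 => /eqP gE; exists (- (d * a)%:R).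
by rewrite -[LHS]natr_Zp yE natrM gE natrM mulrN mulrA mulNr.
Qed.

Section ModularReduction.

Variables p s : nat.
Hypotheses (p_pr : prime p) (s_gt0 : (0 < s)%N).

Let ps_gt1 : (1 < p ^ s)%N.
Proof. by rewrite -(exp1n s) ltn_exp2r ?prime_gt1. Qed.

Lemma natr_mod_Fp a : (a %% (Zp_trunc (p ^ s)).+2)%:R = a%:R :> 'F_p.
Proof.
rewrite (Zp_cast ps_gt1) [in RHS](divn_eq a (p ^ s)) natrD natrM natrX pchar_Fp_0 //.
by rewrite expr0n -[s == 0%N]negbK -lt0n s_gt0 mulr0 add0r.
Qed.

Definition Zp_red (x : 'Z_(p ^ s)) : 'F_p := (x : nat)%:R.

Fact Zp_red_is_zmod_morphism : zmod_morphism Zp_red.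
Proof.
move=> x y; apply/eqP; rewrite eq_sym subr_eq; apply/eqP.
rewrite /Zp_red -[RHS]natrD -[RHS]natr_mod_Fp; congr (_%:R).
by rewrite -{1}(subrK y x).
Qed.

Fact Zp_red_is_monoid_morphism : monoid_morphism Zp_red.
Proof.
split=> [|x y]; first by rewrite /Zp_red /= modn_small.
by rewrite /Zp_red -natrM -[RHS]natr_mod_Fp.
Qed.

HB.instance Definition _ :=
  GRing.isZmodMorphism.Build 'Z_(p ^ s) 'F_p Zp_red Zp_red_is_zmod_morphism.
HB.instance Definition _ :=
  GRing.isMonoidMorphism.Build 'Z_(p ^ s) 'F_p Zp_red Zp_red_is_monoid_morphism.

Lemma Zp_redK : cancel (fun y : 'F_p => (y : nat)%:R) Zp_red.
Proof.
move=> y; rewrite /Zp_red (val_Zp_nat ps_gt1) -{1}(Zp_cast ps_gt1).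
by rewrite natr_mod_Fp natr_Zp.
Qed.

Lemma unit_Zp_red x : Zp_red x != 0 -> x \is a GRing.unit.
Proof.
rewrite /Zp_red -(dvdn_pcharf (pchar_Fp p_pr)) -{2}[x]natr_Zp unitZpE //.
by rewrite coprime_pexpl // prime_coprime.
Qed.

Lemma chain_ring_Zp : chain_ring 'Z_(p ^ s).
Proof.
move=> x y; have gcd_pow (z : 'Z_(p ^ s)) : exists e, gcdn (p ^ s) z = (p ^ e)%N.
  by have /(dvdn_pfactor _ _ p_pr)[e _] := dvdn_gcdl (p ^ s) z; exists e.
have [[i xE] [j yE]] := (gcd_pow x, gcd_pow y).
by have [/dvdn_exp2l dvd_ij|/ltnW/dvdn_exp2l dvd_ji] := leqP i j; [left|right];
  apply: (Zp_dvd_of_gcd ps_gt1); rewrite xE yE.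
Qed.

Lemma maximum_clique_Zp m n (C : {set grassmann 'Z_(p ^ s) n m}) :
  (1 < m)%N -> (2 * m <= n)%N -> maximum_clique grassmann_adj C ->
  is_star C \/ (is_top C /\ (n <= 2 * m)%N).
Proof.
case: m C => // r C r_gt0; rewrite mul2n -addnn => le_n.
have /subnK nE : (r.+1 <= n)%N by apply: leq_trans le_n; apply: leq_addr.
move: (n - r.+1)%N nE => k nE; subst n.
rewrite leq_add2r in le_n; rewrite leq_add2r.
have [T nonsingT] := nonsingular_family_Fp p_pr (leq_trans (ltn0Sn r) le_n) le_n.
apply: (maximum_clique_star_or_top Zp_redK unit_Zp_red chain_ring_Zp nonsingT).
exact: leq_trans r_gt0 le_n.
Qed.

End ModularReduction.

Local Close Scope ring_scope.

Theorem theorem4p6 (p s m n : nat) (p_prime : prime p) (s_gt0 : 0 < s)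
    (m_ge2 : 2 <= m) :
  (2 * m < n ->
     forall C : {set grassmann 'Z_(p ^ s) n m},
       maximum_clique grassmann_adj C -> is_star C) /\
  (n = 2 * m ->
     forall C : {set grassmann 'Z_(p ^ s) n m},
       maximum_clique grassmann_adj C -> is_star C \/ is_top C).
Proof.
split=> [lt_n C maxC|nE C maxC].
  have [//|[_]] := maximum_clique_Zp p_prime s_gt0 m_ge2 (ltnW lt_n) maxC.
  by rewrite leqNgt lt_n.
have le_n : 2 * m <= n by rewrite nE.
by have [|[]] := maximum_clique_Zp p_prime s_gt0 m_ge2 le_n maxC; [left|right].
Qed.
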